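(* Let $X=\{X(t),t\in\mathbb{R}^N\}$ be a centered real-valued Gaussian random field with stationary increments and variogram $v(h)=\mathbb{E}(X(t+h)-X(t))^2$, and let $j\in\{1,\dots,N\}$. Then the mean square partial derivative $X'_j(t)$ exists for all $t\in\mathbb{R}^N$ if and only if the limit $$\lim_{h,k\to0}\frac{v(he_j)+v(ke_j)-v\big((h-k)e_j\big)}{hk}$$ exists. Moreover, this latter condition is equivalent to the existence of the second-order partial derivative of $v$ at $0$ in the $j$-th direction.
   Context: $X$ satisfies $X(0)=0$ and has a continuous covariance function given by $\mathbb{E}[X(s)X(t)]=\int_{\mathbb{R}^N}(e^{i\langle s,\lambda\rangle}-1)(e^{-i\langle t,\lambda\rangle}-1)F(d\lambda)$, where $F$ is a nonnegative symmetric measure on $\mathbb{R}^N\setminus\{0\}$ with $\int\frac{|\lambda|^2}{1+|\lambda|^2}F(d\lambda)<\infty$; so $v(h)=2\int_{\mathbb{R}^N}(1-\cos\langle h,\lambda\rangle)F(d\lambda)$. $e_1,\dots,e_N$ is an orthonormal basis of $\mathbb{R}^N$ (the coordinate directions). The mean square partial derivative $X'_j(t)$ is the $L^2$-limit, as $h\to0$ ($h$ a nonzero real), of $\frac{X(t+he_j)-X(t)}{h}$, when this limit exists. In the double limit, $h$ and $k$ are nonzero reals tending to $0$ independently, and the limit is required to be finite. *)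

(* Defs.v *)
From HB Require Import structures.
From mathcomp Require Import all_boot all_order all_algebra.
From mathcomp Require Import all_classical all_reals all_analysis.
From mathcomp Require Import complex.

Set Implicit Arguments.
Unset Strict Implicit.
Unset Printing Implicit Defensive.

Import Order.TTheory GRing.Theory Num.Theory.
Import numFieldNormedType.Exports.

Local Open Scope classical_set_scope.
Local Open Scope ring_scope.

Definition basis_vec (R : realType) (N : nat) (j : 'I_N) : 'rV[R]_N :=
  delta_mx ord0 j.

(* Not the library norm on ['rV[R]_N], which is the sup norm. *)
Definition dotp (R : realType) (N : nat) (u v : 'rV[R]_N) : R :=
  \sum_(i < N) u ord0 i * v ord0 i.

Definition sqnorm (R : realType) (N : nat) (u : 'rV[R]_N) : R := dotp u u.

Definition borel_rV (R : realType) (N : nat) :=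
  g_sigma_algebraType (@open 'rV[R]_N).

Section random_field.
Context (d : measure_display) (T : measurableType d) (R : realType)
  (P : probability T R) (N : nat).
Implicit Types (X : 'rV[R]_N -> {RV P >-> R}) (v : 'rV[R]_N -> R).

(* Degenerate (Dirac) laws count as Gaussian; they are listed separately because
   [normal_prob m 0] is by convention a uniform law. *)
Definition gaussian_law (Y : T -> R) : Prop :=
  (exists m : R, forall A : set R, measurable A ->
     pushforward P Y A = \d_m A) \/
  (exists m s : R, s != 0 /\ forall A : set R, measurable A ->
     pushforward P Y A = normal_prob m s A).

Definition gaussian_field X : Prop :=
  forall (n : nat) (c : 'I_n -> R) (t : 'I_n -> 'rV[R]_N),
    gaussian_law (fun w => \sum_(i < n) c i * X (t i) w).

Definition centered_field X : Prop := forall t, ('E_P[X t] = 0)%E.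

(* For every h, the fields (X(t + h) - X(h))_t and (X(t) - X(0))_t have the same
   finite-dimensional distributions. *)
Definition stationary_increments X : Prop :=
  forall (h : 'rV[R]_N) (n : nat) (t : 'I_n -> 'rV[R]_N) (A : set (n.-tuple R)),
    measurable A ->
    pushforward P (fun w => [tuple X (t i + h) w - X h w | i < n]) A =
    pushforward P (fun w => [tuple X (t i) w - X 0 w | i < n]) A.

Definition is_variogram X v : Prop :=
  forall t h : 'rV[R]_N,
    ('E_P[fun w => ((X (t + h) w - X t w) ^+ 2)%R] = (v h)%:E)%E.

Definition cov_fun X (s t : 'rV[R]_N) : R := 
  fine 'E_P[fun w => (X s w * X t w)%R]%E.

Definition is_ms_partial_derivative X (j : 'I_N) (t : 'rV[R]_N) (Y : T -> R) :
    Prop :=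
  Y \in Lfun P 2%:E /\
  'E_P[fun w => (((X (t + h *: basis_vec R j) w - X t w) / h - Y w) ^+ 2)%R]%E
    @[h --> (0 : R)^'] --> 0%E.

Definition ms_partial_derivable X (j : 'I_N) (t : 'rV[R]_N) : Prop :=
  exists Y : T -> R, is_ms_partial_derivative X j t Y.

End random_field.

Section spectral_measure.
Context (R : realType) (N : nat).
Implicit Type F : {measure set (borel_rV R N) -> \bar R}.

(* A measure on R^N \ {0} is encoded as a measure on R^N that does not charge
   the origin. *)
Definition is_spectral_measure F : Prop :=
  [/\ F [set (0 : 'rV[R]_N)] = 0%E,
      forall A : set (borel_rV R N), measurable A ->
        F [set - (x : 'rV[R]_N) | x in A] = F A &
      (\int[F]_l (sqnorm l / (1 + sqnorm l))%:E < +oo)%E].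

Definition expi (x : R) : R[i] := Complex (cos x) (sin x).

Definition complex_integral F (f : 'rV[R]_N -> R[i]) : R[i] :=
  Complex (\int[F]_l complex.Re (f l)) (\int[F]_l complex.Im (f l)).

Definition spectral_cov F (s t : 'rV[R]_N) : R[i] :=
  complex_integral F
    (fun l => (expi (dotp s l) - 1) * (expi (- dotp t l) - 1)).

End spectral_measure.

Definition ex_variogram_limit (R : realType) (N : nat)
    (v : 'rV[R]_N -> R) (j : 'I_N) : Prop :=
  exists l : R,
    (v (hk.1 *: basis_vec R j) + v (hk.2 *: basis_vec R j)
       - v ((hk.1 - hk.2) *: basis_vec R j)) / (hk.1 * hk.2)
      @[hk --> filter_prod (0 : R)^' (0 : R)^'] --> l.

(* The limit defining the second derivative is over increments along the j-th
   axis.  Since ['D_] is a total operator, the existence of the first partial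
   derivative on that axis near [a] has to be required separately. *)
Definition second_partial_derivable (R : realType) (N : nat)
    (v : 'rV[R]_N -> R) (j : 'I_N) (a : 'rV[R]_N) : Prop :=
  (\forall x \near (0 : R),
     derivable v (a + x *: basis_vec R j) (basis_vec R j)) /\
  derivable ('D_(basis_vec R j) v) a (basis_vec R j).

(* Main.v *)
(* Writing D_h for the difference quotient of X at t along the axis e_j, the
   polarization identity gives E[D_h D_k] = B(h, k) / 2 with
   B(h, k) = (v(h e_j) + v(k e_j) - v((h - k) e_j)) / (h k), whatever t.
   Hence D_h has an L2-limit iff B has a double limit, by continuity of the
   L2 inner product in one direction, and in the other because
   E[(D_h - D_k)^2] = (B(h, h) + B(k, k)) / 2 - B(h, k) and L2 is complete.
   Let q(x) = v(x e_j), which is even.  Mean square differentiability at x e_j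
   makes q differentiable at x, with derivative twice the inner product of the
   mean square derivative with X(x e_j) - X(0).  Letting k tend to 0 in
   B(x, -k) with x fixed gives q'(x) / x close to the double limit of B, so
   q''(0) is that limit.  Conversely, if q''(0) = a, the mean value theorem
   applied to q(x) - a x^2 / 2, whose derivative is o(x), bounds B - a. *)
Require Import Defs.
From HB Require Import structures.
From mathcomp Require Import all_boot all_order all_algebra.
From mathcomp Require Import all_classical all_reals all_analysis.
From mathcomp Require Import complex.
From mathcomp Require Import measurable_realfun ring lra.

Set Implicit Arguments.
Unset Strict Implicit.
Unset Printing Implicit Defensive.

Import Order.TTheory GRing.Theory Num.Theory.
Import numFieldNormedType.Exports.

Local Open Scope classical_set_scope.
Local Open Scope ring_scope.

(** * Calculus on the line: symmetric differences and second derivatives of even functions *)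

Definition symdiff (R : realType) (q : R -> R) (h k : R) : R :=
  (q h + q k - q (h - k)) / (h * k).

Section symmetric_difference.
Context (R : realType).
Implicit Types (q p : R -> R).

(** The product filter imposes no relation between [h] and [k], so the bound also covers the
    diagonal [h = k], where the Cauchy estimate for difference quotients needs it. *)
Lemma cvg_dnbhs_prodP (B : R -> R -> R) (l : R) :
  (B hk.1 hk.2 @[hk --> filter_prod (0 : R)^' (0 : R)^'] --> l) <->
  (forall e, 0 < e -> exists2 d, 0 < d & forall h k,
     0 < `|h| < d -> 0 < `|k| < d -> `|B h k - l| <= e).
Proof.
split=> [Bl e e0|H].
  have /cvgrPdist_le/(_ e e0)[/= [S S'] [/= [a /= a0 Sa] [b /= b0 Sb]] SS] := Bl.
  exists (Num.min a b); first by rewrite lt_min a0 b0.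
  move=> h k /andP[h0 hab] /andP[k0 kab]; rewrite distrC.
  move: hab kab; rewrite !lt_min => /andP[ha _] /andP[_ kb].
  apply: (SS (h, k)); split => /=.
    by apply: Sa; [rewrite /= sub0r normrN|rewrite -normr_gt0].
  by apply: Sb; [rewrite /= sub0r normrN|rewrite -normr_gt0].
apply/cvgrPdist_le => e e0; have [d d0 dB] := H e e0.
exists ([set h | 0 < `|h| < d], [set h | 0 < `|h| < d]) => /=.
  by split; exists d => //= h; rewrite /= sub0r normrN -normr_gt0 => -> ->.
by move=> [h k] /= [hd kd]; rewrite distrC; exact: dB.
Qed.

Lemma is_derive1P q (x a : R) : is_derive x 1 q a <->
  (q (h + x) - q x) / h @[h --> (0 : R)^'] --> a.
Proof.
have E : (fun h => (q (h + x) - q x) / h) =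
         (fun h => h^-1 *: (q (h *: 1 + x) - q x)).
  by apply/funext => h; rewrite /GRing.scale /= mulr1 mulrC.
split=> [[dq <-]|qa]; rewrite ?E.
  by move: dq; rewrite /derivable /derive.
rewrite E in qa; apply: DeriveDef; last exact: cvg_lim.
by apply/cvg_ex; exists a.
Qed.

Lemma le_cvg_dnbhs (f : R -> R) (a c e : R) :
  f h @[h --> (0 : R)^'] --> a ->
  (exists2 d, 0 < d & forall h, 0 < `|h| < d -> `|f h - c| <= e) ->
  `|a - c| <= e.
Proof.
move=> fa [d d0 fce].
have : `|f h - c| @[h --> (0 : R)^'] --> `|a - c|.
  by apply: cvg_norm; apply: cvgB => //; exact: cvg_cst.
move/cvgr_to_le; apply.
exists d => //= h; rewrite /= sub0r normrN => hd h0; apply: fce.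
by rewrite normr_gt0 h0.
Qed.

(** By the chain rule [q \o -%R], which is [q] itself, has derivative [- a] at 0. *)
Lemma even_is_derive0 q a : (forall x, q (- x) = q x) ->
  is_derive (0 : R) 1 q a -> a = 0.
Proof.
move=> qN qa; have : is_derive (0 : R) 1 (q \o -%R) (a * -1).
  by apply: is_derive1_comp; rewrite oppr0.
have -> : q \o -%R = q by apply/funext => x /=; exact: qN.
move=> [_]; case: qa => _ -> aN; lra.
Qed.

Lemma symdiff_derivable2 q p (l : R) : q 0 = 0 -> (forall x, q (- x) = q x) ->
  (\forall x \near (0 : R), is_derive (x : R) 1 q (p x)) ->
  symdiff q hk.1 hk.2 @[hk --> filter_prod (0 : R)^' (0 : R)^'] --> l ->
  is_derive (0 : R) 1 p l.
Proof.
move=> q00 qN [/= d1 d10 qp] /cvg_dnbhs_prodP Bl.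
have p0 : p 0 = 0.
  by apply: (even_is_derive0 qN); apply: qp; rewrite /= subr0 normr0.
have qp0 (x : R) : `|x| < d1 -> is_derive (x : R) 1 q (p x).
  by move=> xd; apply: qp; rewrite /= sub0r normrN.
apply/is_derive1P/cvgrPdist_le => e e0.
have [d2 d20 dB] := Bl e e0.
exists (Num.min d1 d2); first by rewrite /= lt_min d10 d20.
move=> x; rewrite /= sub0r normrN lt_min => /andP[xd1 xd2] x0.
rewrite p0 addr0 subr0 distrC.
have x0' : 0 < `|x| by rewrite normr_gt0.
(* After multiplication by [|x|], the goal is [|p x - l * x| <= e * |x|]. *)
rewrite -(ler_pM2r x0') -normrM mulrBl divfK //.
have /is_derive1P qx := qp0 _ xd1.
have /is_derive1P q0 : is_derive (0 : R) 1 q 0.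
  by rewrite -[X in is_derive _ _ _ X]p0; apply: qp0; rewrite normr0.
(* The second quotient tends to 0; subtracting it leaves x B(x, -h). *)
have E : (q (h + x) - q x) / h - (q (h + 0) - q 0) / h
    @[h --> (0 : R)^'] --> p x - 0.
  exact: cvgB.
rewrite subr0 in E; apply: (le_cvg_dnbhs E).
exists d2 => // k kd; have k0 : k != 0 by rewrite -normr_gt0; case/andP: kd.
have : `|symdiff q x (- k) - l| <= e by apply: dB; rewrite ?normrN ?x0' ?xd2.
rewrite -(ler_pM2r x0') -normrM; congr (`| _ | <= _).
by rewrite /symdiff opprK qN q00 addr0 (addrC k); field; rewrite k0 x0.
Qed.

Lemma sub_le_derive (r dr : R -> R) (M d x y : R) :
  (forall z : R, `|z| <= d -> is_derive z 1 r (dr z)) ->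
  (forall z, `|z| <= d -> `|dr z| <= M) ->
  `|x| <= d -> `|y| <= d -> `|r x - r y| <= M * `|x - y|.
Proof.
move=> rdr drM; wlog xy : x y / y <= x => [hw xd yd|xd yd].
  have [|/ltW] := leP y x; first by move=> ?; exact: hw.
  by rewrite distrC (distrC x) => ?; exact: hw.
have zd z : z \in `[y, x] -> `|z| <= d.
  move: xd yd; rewrite !ler_norml in_itv /= => /andP[_ ?] /andP[? _] /andP[? ?].
  by apply/andP; split; lra.
have [| |z zyx ->] := @MVT_segment R r dr y x xy.
- move=> z; rewrite in_itv /= => /andP[? ?]; apply: rdr; apply: zd.
  by rewrite in_itv /= !ltW.
- by apply: derivable_within_continuous => z zyx; have [] := rdr z (zd z zyx).
- by rewrite normrM ler_wpM2r//; apply: drM; exact: zd.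
Qed.

(** The quadratic [l / 2 * x ^+ 2] has symmetric difference exactly [l], so the error comes only
    from the remainder [r], whose derivative [dr] is small compared with its argument. *)
Lemma derivable2_symdiff q p (l : R) : q 0 = 0 -> (forall x, q (- x) = q x) ->
  (\forall x \near (0 : R), is_derive (x : R) 1 q (p x)) ->
  is_derive (0 : R) 1 p l ->
  symdiff q hk.1 hk.2 @[hk --> filter_prod (0 : R)^' (0 : R)^'] --> l.
Proof.
move=> q00 qN [/= d1 d10 qp] /is_derive1P /cvgrPdist_le pl.
have p0 : p 0 = 0.
  by apply: (even_is_derive0 qN); apply: qp; rewrite /= subr0 normr0.
apply/cvg_dnbhs_prodP => e e0.
(* One third of [e] pays for [r k - r 0], two thirds for [r h - r (h - k)], where the points may
   have size up to [2 * |h|]. *)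
have [/= d2 d20 pe] := pl (e / 3) ltac:(lra).
(* The division by 4 keeps [h - k], of size at most [2 * d], strictly inside both neighbourhoods. *)
pose d := Num.min d1 d2 / 4.
have m0 : 0 < Num.min d1 d2 by rewrite lt_min d10 d20.
have d0 : 0 < d by rewrite /d divr_gt0.
have dm : 2 * d < Num.min d1 d2 by rewrite /d; lra.
have [dd1 dd2] : 2 * d < d1 /\ 2 * d < d2 by move: dm; rewrite lt_min => /andP[].
pose r x := q x - l / 2 * x ^+ 2.
pose dr x := p x - l * x.
have rdr (z : R) : `|z| <= 2 * d -> is_derive z 1 r (dr z).
  move=> zd; have qz : is_derive z 1 q (p z).
    by apply: qp; rewrite /= sub0r normrN (le_lt_trans zd).
  rewrite (_ : r = q - (l / 2) \*: (id ^+ 2)); last first.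
    by apply/funext => x; rewrite /r.
  by apply: is_derive_eq; rewrite /dr /GRing.scale /=; lra.
have drM z : `|z| <= 2 * d -> `|dr z| <= e / 3 * `|z|.
  move=> zd; have [->|z0] := eqVneq z 0.
    by rewrite /dr p0 mulr0 subr0 !normr0 mulr0.
  have := pe z; rewrite /= sub0r normrN p0 subr0 addr0 => /(_ (le_lt_trans zd dd2) z0).
  have z0' : 0 < `|z| by rewrite normr_gt0.
  by rewrite -(ler_pM2r z0') -normrM mulrBl divfK // distrC.
have rle c x y : c <= 2 * d -> `|x| <= c -> `|y| <= c ->
    `|r x - r y| <= e / 3 * c * `|x - y|.
  move=> cd xc yc; apply: (sub_le_derive (d := c) (dr := dr)) => // z zc.
    by apply: rdr; exact: le_trans cd.
  by rewrite (le_trans (drM z (le_trans zc cd))) // ler_wpM2l //; lra.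
have r0 : r 0 = 0 by rewrite /r q00 expr0n /= mulr0 subr0.
exists d => //.
have main h k : 0 < `|h| < d -> 0 < `|k| < d -> `|k| <= `|h| ->
    `|symdiff q h k - l| <= e.
  move=> /andP[h0 hd] /andP[k0 kd] kh.
  have hk0 : 0 < `|h| * `|k| by rewrite mulr_gt0.
  rewrite -(ler_pM2r hk0) -!normrM.
  (* Grouped so that each difference of values of [r] is taken between points at distance [|k|], the
     smaller of the two steps. *)
  have -> : (symdiff q h k - l) * (h * k) = r k - r 0 + (r h - r (h - k)).
    rewrite /symdiff r0 /r; field; rewrite -!normr_gt0; exact/andP.
  apply: (le_trans (ler_normD _ _)).
  have kd2 : `|k| <= 2 * d.
    by apply: (le_trans (ltW kd)); rewrite ler_peMl ?ler1n // ltW.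
  have hd2 : 2 * `|h| <= 2 * d by rewrite ler_pM2l // ltW.
  have hh2 : `|h| <= 2 * `|h| by rewrite ler_peMl // ler1n.
  have hk2 : `|h - k| <= 2 * `|h|.
    by rewrite (le_trans (ler_normB _ _)) // mulr_natl mulr2n lerD2l.
  have := rle _ k 0 kd2 (lexx _); rewrite normr0 => /(_ (normr_ge0 _)).
  have := rle _ _ _ hd2 hh2 hk2.
  have : e / 3 * `|k| * `|k| <= e / 3 * `|h| * `|k|.
    by rewrite ler_wpM2r // ler_wpM2l // divr_ge0 // ltW.
  rewrite subr0 subKr (normrM h); move: e e0 {pe drM rle} => e; lra.
(* Since [q] is even, [symdiff q] is symmetric in [h] and [k]. *)
move=> h k hd kd; have [kh|/ltW hk] := leP `|k| `|h|; first exact: main.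
by rewrite /symdiff (mulrC h) (addrC (q h)) -(qN (h - k)) opprB; exact: main.
Qed.

End symmetric_difference.

(** * The L2 inner product on square integrable functions *)

Section square_integrable.
Context d (T : measurableType d) (R : realType) (P : probability T R).
Implicit Types f g h : T -> R.
Local Notation L2 := (Lfun P 2%:E).

(** As [fine] sends infinite values to 0, this is tied to the actual expectation only through
    [l2dotE], for members of [L2]. *)
Definition l2dot f g : R := fine 'E_P[fun w => (f w * g w)%R]%E.

Lemma mem_Lfun2 f : measurable_fun setT f ->
  ('E_P[fun w => (f w ^+ 2)%R] < +oo)%E -> f \in L2.
Proof.
move=> mf; rewrite unlock => fy; rewrite inE; apply/andP; split; rewrite inE //=.
rewrite /finite_norm unlock /Lnorm poweR_lty //.
by under eq_integral do rewrite /= powR_mulrn // real_normK ?num_real //.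
Qed.

Lemma Lfun2_measurable f : f \in L2 -> measurable_fun setT f.
Proof. by rewrite inE => /andP[]; rewrite inE. Qed.

Lemma Lfun2B f g : f \in L2 -> g \in L2 -> f - g \in L2.
Proof.
move=> fL gL; have [_ H] := @Lfun_submod_closed _ _ _ P 2%:E (lee1n 2).
by have := H (-1) g f gL fL; rewrite scaleN1r addrC.
Qed.

Lemma Lfun2Z a f : f \in L2 -> a *: f \in L2.
Proof.
move=> fL; have [L0 H] := @Lfun_submod_closed _ _ _ P 2%:E (lee1n 2).
by have := H a f 0 fL L0; rewrite addr0.
Qed.

Lemma l2dotE f g : f \in L2 -> g \in L2 ->
  ('E_P[fun w => (f w * g w)%R] = (l2dot f g)%:E)%E.
Proof.
by move=> fL gL; rewrite fineK // expectation_fin_num //; exact: Lfun2_mul_Lfun1.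
Qed.

Lemma l2sqE f : f \in L2 -> ('E_P[fun w => (f w ^+ 2)%R] = (l2dot f f)%:E)%E.
Proof. by move=> fL; exact: l2dotE. Qed.

Lemma l2dotC f g : l2dot f g = l2dot g f.
Proof. by rewrite /l2dot; under eq_fun do rewrite mulrC. Qed.

Lemma l2dotBl f g h : f \in L2 -> g \in L2 -> h \in L2 ->
  l2dot (f - g) h = l2dot f h - l2dot g h.
Proof.
move=> fL gL hL; apply: EFin_inj; rewrite EFinB -!l2dotE // ?Lfun2B //.
rewrite -expectationB; [|exact: Lfun2_mul_Lfun1..].
by congr ('E_P[_])%E; apply/funext => w /=; rewrite mulrBl.
Qed.

Lemma l2dotZl a f g : f \in L2 -> g \in L2 -> l2dot (a *: f) g = a * l2dot f g.
Proof.
move=> fL gL; apply: EFin_inj; rewrite EFinM -!l2dotE // ?Lfun2Z //.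
rewrite -(expectationZl _ (Lfun2_mul_Lfun1 fL gL)).
by congr ('E_P[_])%E; apply/funext => w; rewrite /= [RHS]mulrC [RHS]mulrA.
Qed.

Lemma l2dotBr f g h : f \in L2 -> g \in L2 -> h \in L2 ->
  l2dot h (f - g) = l2dot h f - l2dot h g.
Proof. by move=> *; rewrite l2dotC l2dotBl // !(l2dotC h). Qed.

Lemma l2dotZr a f g : f \in L2 -> g \in L2 -> l2dot g (a *: f) = a * l2dot g f.
Proof. by move=> *; rewrite l2dotC l2dotZl // (l2dotC g). Qed.

Lemma l2dot_ge0 f : 0 <= l2dot f f.
Proof. by rewrite fine_ge0 // expectation_ge0 // => w; exact: sqr_ge0. Qed.

Lemma l2sqB f g : f \in L2 -> g \in L2 ->
  l2dot (f - g) (f - g) = l2dot f f + l2dot g g - 2 * l2dot f g.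
Proof.
move=> fL gL; rewrite l2dotBl ?Lfun2B // !l2dotBr // (l2dotC g f); lra.
Qed.

Lemma l2sqBB f : l2dot (f - f) (f - f) = 0.
Proof.
by rewrite subrr /l2dot; under eq_fun do rewrite mul0r; rewrite expectation_cst.
Qed.

(** By the parallelogram law the two sides differ by the squared norm of [(f - h) - (h - g)]. *)
Lemma l2sqB_le f g h : f \in L2 -> g \in L2 -> h \in L2 ->
  l2dot (f - g) (f - g) <= 2 * l2dot (f - h) (f - h) + 2 * l2dot (h - g) (h - g).
Proof.
move=> fL gL hL; have := l2dot_ge0 ((f - h) - (h - g)).
rewrite !(l2dotBl, l2dotBr) ?Lfun2B // (l2dotC g f) (l2dotC h f) (l2dotC h g); lra.
Qed.

(** The squared norm of [f - t *: g] is a nonnegative polynomial in [t]. *)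
Lemma l2dot_cauchy_schwarz f g : f \in L2 -> g \in L2 ->
  `|l2dot f g| <= Num.sqrt (l2dot f f) * Num.sqrt (l2dot g g).
Proof.
move=> fL gL; rewrite -sqrtrM ?l2dot_ge0 // -sqrtr_sqr ler_sqrt; last first.
  by rewrite mulr_ge0 ?l2dot_ge0.
have key t : 0 <= l2dot f f + t ^+ 2 * l2dot g g - 2 * t * l2dot f g.
  have := l2dot_ge0 (f - t *: g).
  by rewrite l2sqB ?Lfun2Z // l2dotZl ?Lfun2Z // !l2dotZr // !mulrA expr2.
have := l2dot_ge0 g; have := l2dot_ge0 f.
move: key; set a := l2dot f f; set b := l2dot g g; set c := l2dot f g.
move=> key a0; rewrite le_eqVlt => /predU1P[b0|b0].
  have [->|c0] := eqVneq c 0; first by rewrite -b0 mulr0 expr0n.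
  (* If [b = 0] the polynomial is affine, and this [t] gives it the value -1. *)
  have := key ((a + 1) / (2 * c)); rewrite -b0 mulr0 addr0.
  have -> : 2 * ((a + 1) / (2 * c)) * c = a + 1 by field.
  lra.
(* For [b > 0], [c / b] is the minimizer of the polynomial. *)
have := key (c / b); rewrite -(pmulr_rge0 _ b0).
have -> : b * (a + (c / b) ^+ 2 * b - 2 * (c / b) * c) = a * b - c ^+ 2.
  by field; rewrite gt_eqF.
lra.
Qed.

(** The error splits into three inner products, each bounded by Cauchy-Schwarz. The filter is
    arbitrary so that it can be the product filter, for two independent steps, or the punctured
    neighbourhoods of 0. *)
Lemma l2dot_cvg (I : Type) (F : set_system I) {FF : ProperFilter F}
    (u v : I -> T -> R) f g :
  (forall i, u i \in L2) -> (forall i, v i \in L2) -> f \in L2 -> g \in L2 ->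
  l2dot (u i - f) (u i - f) @[i --> F] --> 0 ->
  l2dot (v i - g) (v i - g) @[i --> F] --> 0 ->
  l2dot (u i) (v i) @[i --> F] --> l2dot f g.
Proof.
move=> uL vL fL gL uf vg.
have sq0 (x : I -> R) : x i @[i --> F] --> 0 -> Num.sqrt (x i) @[i --> F] --> 0.
  move=> x0; rewrite -[X in _ --> X]sqrtr0.
  by apply: continuous_cvg => //; exact: sqrt_continuous.
pose B i :=
  Num.sqrt (l2dot (u i - f) (u i - f)) * Num.sqrt (l2dot (v i - g) (v i - g))
  + Num.sqrt (l2dot (u i - f) (u i - f)) * Num.sqrt (l2dot g g)
  + Num.sqrt (l2dot f f) * Num.sqrt (l2dot (v i - g) (v i - g)).
have B0 : B i @[i --> F] --> 0.
  rewrite [X in _ --> X](_ : 0 = 0 * 0 + 0 * Num.sqrt (l2dot g g)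
    + Num.sqrt (l2dot f f) * 0); last by rewrite !mul0r mulr0 !addr0.
  by apply: cvgD; [apply: cvgD|]; apply: cvgM; (try exact: cvg_cst); exact: sq0.
apply/cvgrPdist_le => e e0.
have /cvgrPdist_le /(_ e e0) := B0; apply: filterS => i; rewrite sub0r normrN.
move=> /(le_trans (ler_norm _)); apply: le_trans.
rewrite distrC.
have -> : l2dot (u i) (v i) - l2dot f g = l2dot (u i - f) (v i - g) +
  l2dot (u i - f) g + l2dot f (v i - g).
  by rewrite !(l2dotBl, l2dotBr) ?Lfun2B //; lra.
rewrite (le_trans (ler_normD _ _)) // lerD ?(le_trans (ler_normD _ _)) ?lerD //;
  by rewrite l2dot_cauchy_schwarz ?Lfun2B.
Qed.

End square_integrable.

(** * Completeness of L2 *)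

Section completeness.
Context d (T : measurableType d) (R : realType) (P : probability T R).
Implicit Types f g h : T -> R.
Local Notation L2 := (Lfun P 2%:E).

(* AM-GM: [|f| <= (f^2 / c + c) / 2]. *)
Lemma expectation_abs_le f (c : R) : 0 < c -> f \in L2 ->
  ('E_P[fun w => `|f w|%R] <= ((l2dot P f f / c + c) / 2)%:E)%E.
Proof.
move=> c0 fL; have mf := Lfun2_measurable fL.
have L1 : (fun w => f w ^+ 2) \in Lfun P 1 by exact: (Lfun2_mul_Lfun1 fL fL).
have C1 : (cst c : T -> R) \in Lfun P 1 by exact: Lfun_cst.
pose b : T -> R := (2^-1 \o* ((c^-1 \o* (fun w => f w ^+ 2)) \+ cst c)).
have Eb : ('E_P[b] = ((l2dot P f f / c + c) / 2)%:E)%E.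
  rewrite /b expectationZl; last first.
    by rewrite rpredD // Lfun_scale.
  rewrite expectationD //; last exact: Lfun_scale.
  rewrite expectationZl // expectation_cst (l2sqE fL).
  by rewrite mulrC (mulrC (l2dot _ _ _)).
rewrite -Eb; apply: expectation_le => //.
- exact: measurableT_comp.
- apply: measurable_funM => //; apply: measurable_funD => //.
  by apply: measurable_funM => //; exact: measurable_funX.
- move=> w; rewrite /b /= mulr_ge0 ?invr_ge0 // addr_ge0 ?(ltW c0) //.
  by rewrite mulr_ge0 ?sqr_ge0 // invr_ge0 ltW.
- apply: nearW => w; rewrite /b /= -(ler_pM2r c0) -subr_ge0.
  have -> : (f w ^+ 2 / c + c) / 2 * c - `|f w| * c = (`|f w| - c) ^+ 2 / 2.
    by rewrite -(real_normK (num_real (f w))); field; rewrite gt_eqF.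
  by rewrite divr_ge0 // sqr_ge0.
Qed.

(** Integrating termwise, the sum of the [|u n|] is integrable, hence finite almost everywhere, and
    absolute convergence implies convergence. *)
Lemma ae_cvg_series (mu : {measure set T -> \bar R}) (u : nat -> T -> R) :
  (forall n, measurable_fun setT (u n)) ->
  (\sum_(n <oo) \int[mu]_w (`|u n w|)%:E < +oo)%E ->
  {ae mu, forall w, cvgn (series (fun n => u n w))}.
Proof.
move=> mu_ uy.
have mau n : measurable_fun setT (fun w => (`|u n w|)%:E).
  by apply/measurable_EFinP; exact: measurableT_comp.
have : mu.-integrable setT (fun w => \sum_(n <oo) (`|u n w|)%:E)%E.
  apply/integrableP; split.
    by apply: ge0_emeasurable_sum => // k w _ _; rewrite lee_fin.
  under eq_integral do rewrite gee0_abs ?nneseries_ge0 //.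
  by rewrite integral_nneseries // => n w _; rewrite lee_fin.
move=> /(integrable_ae measurableT); apply: filterS => w /(_ I) wfin.
apply: normed_cvg; rewrite /normed_series_of /=.
apply: nondecreasing_is_cvgn.
  by apply: nondecreasing_series => n _ _; exact: normr_ge0.
exists (fine (\sum_(n <oo) (`|u n w|)%:E)%E) => _ [n _ <-].
rewrite -lee_fin fineK // /series /= -sumEFin.
by apply: nneseries_lim_ge => k _ _; rewrite lee_fin.
Qed.

Lemma limn_einf_le_near (u : (\bar R)^nat) (c : \bar R) :
  (\forall n \near \oo, (u n <= c)%E) -> (limn_einf u <= c)%E.
Proof.
move=> uc; rewrite limn_einf_lim; apply: lime_le; first exact: is_cvg_einfs.
apply: filterS uc => n; apply: le_trans; apply: ereal_inf_lbound.
by exists n => /=.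
Qed.

Lemma fast_subsequence (f : nat -> T -> R) :
  (forall e, 0 < e -> exists N, forall n m, (N <= n)%N -> (N <= m)%N ->
     l2dot P (f n - f m) (f n - f m) <= e) ->
  exists s : nat -> nat, (forall k, (k <= s k)%N) /\
    forall k, l2dot P (f (s k.+1) - f (s k)) (f (s k.+1) - f (s k))
              <= ((2 ^ k.+1)%:R^-1) ^+ 2.
Proof.
move=> fC.
have /choice[N NP] (k : nat) : exists N, forall n m, (N <= n)%N -> (N <= m)%N ->
     l2dot P (f n - f m) (f n - f m) <= ((2 ^ k.+1)%:R^-1) ^+ 2.
  by apply: fC; rewrite exprn_gt0 // invr_gt0 ltr0n expn_gt0.
(* The sum dominates [N k] both at [k] and at [k.+1]; the added [k] makes the index at least [k]. *)
exists (fun k => k + \sum_(i < k.+1) N i)%N; split=> [k|k]; first exact: leq_addr.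
have Nk : (N k <= \sum_(i < k.+1) N i)%N by rewrite big_ord_recr leq_addl.
apply: NP; last exact: leq_trans Nk (leq_addl _ _).
rewrite big_ord_recr; apply: leq_trans (leq_addl _ _).
exact: leq_trans Nk (leq_addr _ _).
Qed.

(** Riesz-Fischer: a fast subsequence converges almost everywhere, and Fatou's lemma carries the
    Cauchy bounds of the whole sequence over to its limit. *)
Lemma Lfun2_complete (f : nat -> T -> R) : (forall n, f n \in L2) ->
  (forall e, 0 < e -> exists N, forall n m, (N <= n)%N -> (N <= m)%N ->
     l2dot P (f n - f m) (f n - f m) <= e) ->
  exists2 g, g \in L2 & l2dot P (f n - g) (f n - g) @[n --> \oo] --> 0.
Proof.
move=> fL fC; have mf n := Lfun2_measurable (fL n).
have [s [ks sP]] := fast_subsequence fC.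
have ae_cvg : {ae P, forall w, cvgn (fun k => f (s k) w)}.
  have /ae_cvg_series : forall k, measurable_fun setT (f (s k.+1) - f (s k)).
    by move=> k; exact: measurable_funB.
  move/(_ P); have uy :
      (\sum_(k <oo) \int[P]_w (`|(f (s k.+1) - f (s k)) w|)%:E < +oo)%E.
    apply: (@le_lt_trans _ _ 1%:E); last by rewrite ltry.
    apply: le_trans (epsilon_trick0 xpredT (@ler01 R)).
    apply: lee_nneseries => k _.
      by rewrite integral_ge0 // => w _; rewrite lee_fin.
    (* With [c] equal to [2 ^ k.+1] inverted, the squared norm is at most [c ^+ 2], so the integral
       is at most [c]; these values sum to at most 1. *)
    have c0 : 0 < (2 ^ k.+1)%:R^-1 :> R by rewrite invr_gt0 ltr0n expn_gt0.
    have := expectation_abs_le c0 (Lfun2B (fL (s k.+1)) (fL (s k))).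
    rewrite expectation.unlock => /le_trans; apply; rewrite lee_fin div1r.
    have := sP k; rewrite expr2 -ler_pdivrMr //; lra.
  move=> /(_ uy); apply: filterS => w /= H.
  have -> : (fun k => f (s k) w) =
      (fun k => f (s 0) w + series (fun n => (f (s n.+1) - f (s n)) w) k).
    apply/funext => k.
    by rewrite {1}[f (s k) w](eq_sum_telescope (fun k => f (s k) w)).
  by apply: is_cvgD => //; exact: is_cvg_cst.
(* A limsup, so that g is measurable; its value is junk where f (s k) diverges. *)
pose g w := fine (limn_esup (fun k => (f (s k) w)%:E)).
have mg : measurable_fun setT g.
  apply: measurableT_comp => //; apply: measurable_fun_limn_esup => k.
  exact/measurable_EFinP.
have fg : {ae P, forall w, f (s k) w @[k --> \oo] --> g w}.
  apply: filterS ae_cvg => w /cvg_ex[l fl].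
  have : (f (s k) w)%:E @[k --> \oo] --> l%:E by apply: cvg_EFin => //; exact: nearW.
  by move/cvg_limn_einf_sup => [_ El]; rewrite /g El.
(* Fatou in [k] with [n] fixed: almost everywhere [(f n - g) ^+ 2] is the limit of
   [(f n - f (s k)) ^+ 2], whose integral is at most [e] once [N <= k], as [k <= s k]. *)
have fng e N : (forall n m, (N <= n)%N -> (N <= m)%N ->
     l2dot P (f n - f m) (f n - f m) <= e) -> forall n, (N <= n)%N ->
     ('E_P[fun w => ((f n - g) w ^+ 2)%R] <= e%:E)%E.
  move=> fe n Nn; rewrite unlock.
  have mfk k : measurable_fun setT (fun w => ((f n w - f (s k) w) ^+ 2)%:E).
    by apply/measurable_EFinP; apply: measurable_funX; exact: measurable_funB.
  rewrite (@ge0_ae_eq_integral _ _ _ P setT _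
    (fun w => limn_einf (fun k => ((f n w - f (s k) w) ^+ 2)%:E))) //.
  - apply: (le_trans (fatou _ _ _ _)) => //.
      by move=> k w _; rewrite lee_fin sqr_ge0.
    apply: limn_einf_le_near; exists N => // k /= Nk.
    have := l2sqE (Lfun2B (fL n) (fL (s k))).
    by rewrite unlock => ->; rewrite lee_fin fe // (leq_trans Nk).
  - apply/measurable_EFinP; apply: measurable_funX; exact: measurable_funB.
  - rewrite /limn_einf; apply: measurableT_comp => //.
    apply: measurable_fun_limn_esup => k; exact: measurableT_comp.
  - by move=> w _; rewrite lee_fin sqr_ge0.
  - move=> w _; rewrite limn_einf_lim; apply: lime_ge; first exact: is_cvg_einfs.
    apply: nearW => k; apply: le_ereal_inf_tmp => _ [m _ <-].
    by rewrite lee_fin sqr_ge0.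
  - apply: filterS fg => w fgw _; apply/esym.
    have : ((f n w - f (s k) w) ^+ 2)%:E @[k --> \oo] --> ((f n w - g w) ^+ 2)%:E.
      apply: cvg_EFin; first exact: nearW.
      have H : f n w - f (s k) w @[k --> \oo] --> f n w - g w.
        by apply: cvgB => //; exact: cvg_cst.
      exact: (cvgM H H).
    by move/cvg_limn_einf_sup => [].
have fgL n : f n - g \in L2.
  (* Any finite bound on the second moment of one [f N - g] will do; 1 is arbitrary. *)
  have [N fe] := fC 1 ltr01.
  have fNL : f N - g \in L2.
    apply: mem_Lfun2; first exact: measurable_funB.
    by apply: (le_lt_trans (fng _ _ fe N _)) => //; rewrite ltry.
  have -> : f n - g = (f n - f N) - - (f N - g) by rewrite opprK addrA subrK.
  by rewrite Lfun2B // ?Lfun2B // -scaleN1r Lfun2Z.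
exists g; first by rewrite -[g](subKr (f 0)) Lfun2B.
apply/cvgrPdist_le => e e0; have [N fe] := fC e e0.
exists N => // n /= Nn; rewrite sub0r normrN ger0_norm ?l2dot_ge0 //.
by rewrite -lee_fin -l2sqE //; exact: fng fe n Nn.
Qed.

End completeness.

(** * Directional derivatives as derivatives on an axis *)

Lemma is_derive_axis (R : realType) (V : normedModType R) (f : V -> R) (u : V)
    (x a : R) :
  is_derive (x *: u) u f a <-> is_derive x 1 (fun y : R => f (y *: u)) a.
Proof.
have E : (fun h : R => h^-1 *: (f (h *: u + x *: u) - f (x *: u))) =
    (fun h : R => h^-1 *: (f ((h *: (1 : R) + x) *: u) - f (x *: u))).
  by apply/funext => h; rewrite -scalerDl /GRing.scale /= mulr1.
split=> -[df <-]; (split; [move: df; rewrite /derivable|rewrite /derive]).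
- by rewrite E.
- by rewrite E.
- by rewrite -E.
- by rewrite -E.
Qed.

(** * Increments, difference quotients and the variogram *)

Section variogram.
Context d (T : measurableType d) (R : realType) (P : probability T R) (N : nat).
Context (X : 'rV[R]_N -> {RV P >-> R}) (v : 'rV[R]_N -> R).
Context (v_variogram : is_variogram X v).
Local Notation L2 := (Lfun P 2%:E).
Implicit Types (s t u : 'rV[R]_N) (Y : T -> R).

Definition increment s t : T -> R := (X s : T -> R) - (X t : T -> R).

Lemma variogram_increment s t :
  ('E_P[fun w => (increment s t w ^+ 2)%R] = (v (s - t))%:E)%E.
Proof. by rewrite -(v_variogram t) addrC subrK. Qed.

(** The second moment is finite because the variogram takes real values. *)
Lemma increment_Lfun2 s t : increment s t \in L2.
Proof.
apply: mem_Lfun2; first exact: measurable_funB.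
by rewrite variogram_increment ltry.
Qed.

Lemma l2sq_increment s t : l2dot P (increment s t) (increment s t) = v (s - t).
Proof.
by apply: EFin_inj; rewrite -l2sqE ?increment_Lfun2 // variogram_increment.
Qed.

Lemma variogram0 : v 0 = 0.
Proof. by rewrite -(subrr 0) -l2sq_increment l2sqBB. Qed.

Lemma variogramN u : v (- u) = v u.
Proof.
rewrite -(sub0r u) -l2sq_increment -[in RHS](subr0 u) -l2sq_increment /l2dot.
by congr (fine 'E_P[_]%E); apply/funext => w; rewrite -mulrNN /= !opprB.
Qed.

(** Polarization: the difference of two increments from the base point [t] is again an increment. *)
Lemma l2dot_increment r s t :
  l2dot P (increment r t) (increment s t) = (v (r - t) + v (s - t) - v (r - s)) / 2.
Proof.
rewrite -!l2sq_increment.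
have -> : increment r s = increment r t - increment s t.
  by rewrite /increment opprB addrA subrK.
by rewrite l2sqB ?increment_Lfun2 //; lra.
Qed.

Context (j : 'I_N).
Local Notation e_j := (basis_vec R j).
Local Notation q := (fun x : R => v (x *: e_j)).

Definition diffquot t (h : R) : T -> R := h^-1 *: increment (t + h *: e_j) t.

Lemma diffquot_Lfun2 t h : diffquot t h \in L2.
Proof. by rewrite Lfun2Z ?increment_Lfun2. Qed.

(** The base point cancels, so a single double limit governs all [t]. Both sides vanish when [h] or
    [k] is 0, the inverse of 0 being 0. *)
Lemma l2dot_diffquot t h k :
  l2dot P (diffquot t h) (diffquot t k) = symdiff q h k / 2.
Proof.
rewrite l2dotZl ?diffquot_Lfun2 ?increment_Lfun2 //.
rewrite l2dotZr ?increment_Lfun2 // l2dot_increment.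
have -> : t + h *: e_j - (t + k *: e_j) = (h - k) *: e_j.
  by rewrite scalerBl opprD addrACA subrr add0r.
rewrite (addrAC t (h *: e_j)) (addrAC t (k *: e_j)) subrr !add0r /symdiff.
by rewrite invfM; ring.
Qed.

Lemma l2sq_diffquotB t h k :
  l2dot P (diffquot t h - diffquot t k) (diffquot t h - diffquot t k) =
  (symdiff q h h + symdiff q k k) / 2 - symdiff q h k.
Proof. by rewrite l2sqB ?diffquot_Lfun2 // !l2dot_diffquot; lra. Qed.

Lemma is_ms_partial_derivativeP t Y : is_ms_partial_derivative X j t Y <->
  Y \in L2 /\
  l2dot P (diffquot t h - Y) (diffquot t h - Y) @[h --> (0 : R)^'] --> 0.
Proof.
rewrite /is_ms_partial_derivative.
have E : Y \in L2 ->
    (fun h : R => 'E_P[fun w =>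
       (((X (t + h *: e_j) w - X t w) / h - Y w) ^+ 2)%R]%E) =
    (fun h => (l2dot P (diffquot t h - Y) (diffquot t h - Y))%:E).
  move=> YL; apply/funext => h; rewrite -l2sqE ?Lfun2B ?diffquot_Lfun2 //.
  by congr ('E_P[_])%E; apply/funext => w; rewrite mulrC.
split=> -[YL]; rewrite E //.
- by move/fine_cvg.
- by move=> H; split => //; apply: cvg_EFin => //; exact: nearW.
Qed.

Lemma symdiff_cvg_of_ms_derivative t Y : is_ms_partial_derivative X j t Y ->
  symdiff q hk.1 hk.2 @[hk --> filter_prod (0 : R)^' (0 : R)^']
    --> 2 * l2dot P Y Y.
Proof.
move=> /is_ms_partial_derivativeP[YL DY].
have E : (fun hk => symdiff q hk.1 hk.2) =
    (fun hk => 2 * l2dot P (diffquot t hk.1) (diffquot t hk.2)).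
  by apply/funext => hk; rewrite l2dot_diffquot; lra.
rewrite E; apply: cvgM; first exact: cvg_cst.
apply: l2dot_cvg => // [hk|hk||]; try exact: diffquot_Lfun2.
- exact: (cvg_comp _ _ cvg_fst DY).
- exact: (cvg_comp _ _ cvg_snd DY).
Qed.

(** The quotients are Cauchy as the step tends to 0. Completeness gives a limit [Y] along the steps
    [n.+1%:R^-1], and comparison with one such step extends the convergence to all [h]. *)
Lemma ms_derivable_of_symdiff_cvg t (l : R) :
  symdiff q hk.1 hk.2 @[hk --> filter_prod (0 : R)^' (0 : R)^'] --> l ->
  ms_partial_derivable X j t.
Proof.
move=> /cvg_dnbhs_prodP Bl.
have DC e : 0 < e -> exists2 d, 0 < d &
    forall h k, 0 < `|h| < d -> 0 < `|k| < d ->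
    l2dot P (diffquot t h - diffquot t k) (diffquot t h - diffquot t k) <= e.
  (* The three values of [symdiff] carry weights 1/2, 1/2 and 1, so errors of [e / 2] add up to
     [e]. *)
  move=> e0; have [d0 d00 dB] := Bl (e / 2) ltac:(lra).
  exists d0 => // h k hd kd; rewrite l2sq_diffquotB.
  have := dB _ _ hd hd; have := dB _ _ hd kd; have := dB _ _ kd kd.
  rewrite !ler_norml => /andP[? ?] /andP[? ?] /andP[? ?]; lra.
have small d0 : 0 < d0 ->
    exists M, forall n, (M <= n)%N -> 0 < `|n.+1%:R^-1 : R| < d0.
  move=> d00; have /cvgrPdist_lt /(_ _ d00) [M _ MP] := @cvg_harmonic R.
  exists M => n Mn; rewrite normr_gt0 invr_neq0 ?pnatr_eq0 //.
  by have := MP n Mn; rewrite /= sub0r normrN.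
have [|e e0|Y YL fY] := @Lfun2_complete _ _ _ P (fun n => diffquot t n.+1%:R^-1).
- by move=> n; exact: diffquot_Lfun2.
- have [d0 d00 dD] := DC e e0; have [M MP] := small d0 d00.
  by exists M => n m nM mM; apply: dD; exact: MP.
exists Y; apply/is_ms_partial_derivativeP; split => //.
(* [l2sqB_le] doubles each of the two squared distances, hence [e / 4]. *)
apply/cvgrPdist_le => e e0; have [d0 d00 dD] := DC (e / 4) ltac:(lra).
have [M MP] := small d0 d00.
have [|M' _ M'P] := (cvgrPdist_le _ _).1 fY (e / 4); first lra.
exists d0 => //= h; rewrite /= !sub0r !normrN => hd h0.
rewrite ger0_norm ?l2dot_ge0 //.
pose n := maxn M M'; pose D := diffquot t n.+1%:R^-1.
have := M'P n (leq_maxr _ _); rewrite sub0r normrN => /(le_trans (ler_norm _)).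
have := dD h n.+1%:R^-1; rewrite normr_gt0 h0 hd (MP n (leq_maxl _ _)) => /(_ isT isT).
have := @l2sqB_le _ _ _ P (diffquot t h) Y D; rewrite !diffquot_Lfun2 // YL.
move=> /(_ isT isT isT).
rewrite -/D; lra.
Qed.

(** With [D] the quotient at [t = x *: e_j] and [W] the increment from [t] to 0,
    [X (t + h *: e_j) - X 0] is [h *: D - W]. Expanding its squared norm, subtracting that of [W]
    and dividing by [h] leaves [h * l2dot P D D - 2 * l2dot P D W]. *)
Lemma is_derive_variogram_axis (x : R) Y :
  is_ms_partial_derivative X j (x *: e_j) Y ->
  is_derive x 1 q (- 2 * l2dot P Y (increment 0 (x *: e_j))).
Proof.
move=> /is_ms_partial_derivativeP[YL DY]; apply/is_derive1P.
pose t : 'rV[R]_N := x *: e_j; rewrite -/t in DY *; set W := increment 0 t.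
have WL : W \in L2 by exact: increment_Lfun2.
have lim : h * l2dot P (diffquot t h) (diffquot t h) + - 2 * l2dot P (diffquot t h) W
    @[h --> (0 : R)^'] --> - 2 * l2dot P Y W.
  (* The squared norms of the quotients converge, so the first term tends to [0 * l2dot P Y Y]. *)
  rewrite -[X in _ --> X]add0r -[X in _ --> X + _](mul0r (l2dot P Y Y)).
  apply: cvgD; apply: cvgM; [exact: cvg_within|..|exact: cvg_cst|].
    by apply: l2dot_cvg => // h; exact: diffquot_Lfun2.
  apply: l2dot_cvg => // [h|]; first exact: diffquot_Lfun2.
  by apply: cvg_near_cst; apply: nearW => h; exact: l2sqBB.
apply: cvg_trans lim; apply: near_eq_cvg; exists 1 => //= h _ h0.
rewrite l2dot_diffquot (@l2dotZl _ _ _ P) ?increment_Lfun2 // l2dot_increment.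
rewrite (addrAC t) subrr add0r sub0r subr0 variogramN /symdiff.
rewrite subrr scale0r variogram0.
have -> : t + h *: e_j = (h + x) *: e_j by rewrite scalerDl addrC.
rewrite -/t.
by move: (v _) (v _) (v _) => a b c; field.
Qed.

Lemma second_partial_derivableP : second_partial_derivable v j 0 <->
  (\forall x \near (0 : R), derivable q x 1) /\
  derivable (fun y : R => 'D_e_j v (y *: e_j)) 0 1.
Proof.
have der (f : 'rV[R]_N -> R) (x : R) :
    derivable f (x *: e_j) e_j <-> derivable (fun y : R => f (y *: e_j)) x 1.
  split=> /derivableP H.
    by have /is_derive_axis [] := H.
  by have /is_derive_axis [] := H.
rewrite /second_partial_derivable -[X in derivable ('D__ _) X](scale0r e_j) der.
split=> -[vd vdd]; (split; last exact: vdd).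
  by apply: filterS vd => x; rewrite add0r => /der.
by apply: filterS vd => x; rewrite add0r; exact: (der v x).2.
Qed.

(** Derivability of [q] near 0 ensures that ['D_e_j v] on the axis is there the true derivative [p]
    of [q], as both calculus lemmas on [symdiff] require. *)
Lemma symdiff_cvg_second_partial (l : R) :
  (\forall x \near (0 : R), derivable q x 1) ->
  symdiff q hk.1 hk.2 @[hk --> filter_prod (0 : R)^' (0 : R)^'] --> l <->
  is_derive (0 : R) 1 (fun y : R => 'D_e_j v (y *: e_j)) l.
Proof.
move=> qd.
have q0 : q 0 = 0 by rewrite scale0r variogram0.
have qN x : q (- x) = q x by rewrite scaleNr variogramN.
have qp : \forall x \near (0 : R), is_derive (x : R) 1 q ('D_e_j v (x *: e_j)).
  apply: filterS qd => x /derivableP qx.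
  by have /is_derive_axis [_ ->] := qx.
by split; [exact: symdiff_derivable2|exact: derivable2_symdiff].
Qed.

End variogram.

(** * The two equivalences for the random field *)

Theorem theorem4p2 (d : measure_display) (T : measurableType d) (R : realType)
  (P : probability T R) (N : nat) (X : 'rV[R]_N -> {RV P >-> R})
  (F : {measure set (borel_rV R N) -> \bar R}) (v : 'rV[R]_N -> R) (j : 'I_N)
  (X_gaussian : gaussian_field X)
  (X_centered : centered_field X)
  (X_stationary : stationary_increments X)
  (X0 : {ae P, forall w, X 0 w = 0})
  (X_cov_continuous : continuous
     (fun st : 'rV[R]_N * 'rV[R]_N => cov_fun X st.1 st.2))
  (F_spectral : is_spectral_measure F)
  (X_cov : forall s t : 'rV[R]_N,
     Complex (cov_fun X s t) 0 = spectral_cov F s t)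
  (v_variogram : is_variogram X v) :
  ((forall t : 'rV[R]_N, ms_partial_derivable X j t) <->
     ex_variogram_limit v j) /\
  (ex_variogram_limit v j <-> second_partial_derivable v j 0).
Proof.
(* Used twice: for the first equivalence, and to make the variogram derivable along the axis in the
   second. *)
have ms_of_limit : ex_variogram_limit v j -> forall t, ms_partial_derivable X j t.
  by move=> [l vl] t; exact: (ms_derivable_of_symdiff_cvg v_variogram t vl).
split.
  split=> // msX; have [Y /(symdiff_cvg_of_ms_derivative v_variogram) vY] := msX 0.
  by exists (2 * l2dot P Y Y).
split.
  move=> /[dup] /ms_of_limit msX [l vl]; apply/second_partial_derivableP.
  have qd : \forall x \near (0 : R),
      derivable (fun y : R => v (y *: basis_vec R j)) x 1.
    (* The radius is arbitrary: the mean square derivative exists at every point of the axis. *)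
    exists 1 => //= x _; have [Y] := msX (x *: basis_vec R j).
    by move/(is_derive_variogram_axis v_variogram) => [].
  by split => //; have [] := (symdiff_cvg_second_partial v_variogram l qd).1 vl.
move=> /second_partial_derivableP[qd /derivableP qdd]; eexists.
exact: ((symdiff_cvg_second_partial v_variogram _ qd).2 qdd).
Qed.
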